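(* Let $X$ be an irreducible continuum. Then $X$ is either indecomposable or continuously irreducible if and only if the set function $\mathcal{T}\colon 2^X\to 2^X$ is continuous.
   Context: A continuum is a compact, connected, nonempty metric space; a subcontinuum of $X$ is a subset of $X$ that is a continuum. A continuum is decomposable if it is the union of two proper subcontinua, and indecomposable otherwise. For a continuum $X$, $2^X$ denotes the set of all nonempty closed subsets of $X$ with the Hausdorff metric. Jones' set function $\mathcal{T}$ is defined for every $A\subseteq X$ by $$\mathcal{T}(A)=X\setminus\{x\in X : \text{there is a subcontinuum } W \text{ of } X \text{ with } x\in W^{\circ}\subseteq W\subseteq X\setminus A\},$$ where $W^\circ$ is the interior of $W$ in $X$. If $A\in 2^X$ then $\mathcal{T}(A)\in 2^X$, and continuity of $\mathcal{T}$ refers to its restriction $2^X\to 2^X$. A continuum $X$ is irreducible if there are two points $p,q\in X$ such that no proper subcontinuum of $X$ contains both $p$ and $q$. A continuum $X$ is of type $\lambda$ if $X$ is irreducible and each indecomposable subcontinuum of $X$ has empty interior in $X$. A decomposition of $X$ is a family of nonempty, mutually disjoint subsets of $X$ whose union is $X$; it is monotone if its elements are connected, upper semicontinuous if its elements are closed and the quotient map is closed, and continuous if the quotient map is both closed and open. It is a known fact (Thomas) that a continuum $X$ is of type $\lambda$ if and only if it admits a finest monotone upper semicontinuous decomposition $\mathcal{G}$ such that each element of $\mathcal{G}$ is nowhere dense in $X$ and $X/\mathcal{G}$ is an arc (a space homeomorphic to $[0,1]$). A continuum $X$ is continuously irreducible if $X$ is of type $\lambda$ and this decomposition $\mathcal{G}$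 is continuous. *)

(* Defs.v *)
From HB Require Import structures.
From mathcomp Require Import all_boot all_order all_algebra.
From mathcomp Require Import all_classical all_reals all_analysis.
Set Implicit Arguments.
Unset Strict Implicit.
Unset Printing Implicit Defensive.
Import Order.TTheory GRing.Theory Num.Theory.
Import numFieldNormedType.Exports.

Local Open Scope classical_set_scope.
Local Open Scope ring_scope.

HB.mixin Record isContinuum (R : realType) X & Metric R X := {
  continuum_compact : compact [set: X] ;
  continuum_connected : connected [set: X] ;
  continuum_nonempty : [set: X] !=set0
}.

#[short(type="continuumType")]
HB.structure Definition Continuum (R : realType) :=
  { X of Metric R X & isContinuum R X }.

(* Compactness and connectedness of a subset are those of the subspace, so a
   subcontinuum of a subcontinuum K of X is a subcontinuum of X included in
   K. *)
Definition subcontinuum (X : topologicalType) (W : set X) : Prop :=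
  [/\ compact W, connected W & W !=set0].

Definition decomposable (X : topologicalType) (K : set X) : Prop :=
  exists A B : set X,
    [/\ subcontinuum A, subcontinuum B, A `<` K, B `<` K & K = A `|` B].

Definition indecomposable (X : topologicalType) (K : set X) : Prop :=
  ~ decomposable K.

Definition irreducible (X : topologicalType) : Prop :=
  exists p q : X,
    ~ exists W : set X, [/\ subcontinuum W, W `<` [set: X], W p & W q].

Definition type_lambda (X : topologicalType) : Prop :=
  irreducible X /\
  forall K : set X, subcontinuum K -> indecomposable K -> K° = set0.

Definition nowhere_dense (X : topologicalType) (A : set X) : Prop :=
  (closure A)° = set0.

Definition closed_map (X Y : topologicalType) (f : X -> Y) : Prop :=
  forall F : set X, closed F -> closed (f @` F).

Definition open_map (X Y : topologicalType) (f : X -> Y) : Prop :=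
  forall U : set X, open U -> open (f @` U).

Definition homeomorphic (X Y : topologicalType) : Prop :=
  exists (f : X -> Y) (g : Y -> X),
    [/\ continuous f, continuous g, cancel f g & cancel g f].

Definition is_arc (R : realType) (Y : topologicalType) : Prop :=
  homeomorphic Y (set_type (`[0, 1]%classic : set R)).

Definition decomposition (X : Type) (G : set (set X)) : Prop :=
  [/\ forall A, G A -> A !=set0,
      forall A B, G A -> G B -> A <> B -> A `&` B = set0
    & \bigcup_(A in G) A = [set: X]].

Section Quotient.
Context {X : topologicalType} (G : set (set X)).

(* Stated so as to be an equivalence relation for every family G; see
   same_blockP for the case of a decomposition. *)
Definition same_block (x y : X) : bool :=
  `[< forall A, G A -> (A x <-> A y) >].

Lemma same_blockP (A : set X) (x y : X) :
  decomposition G -> G A -> A x -> reflect (A y) (same_block x y).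
Proof.
move=> [_ dG _] GA Ax; apply: (iffP (asboolP _)) => [/(_ A GA)[Axy _]|Ay B GB].
  exact: Axy.
have [->|/(dG _ _ GB GA) BA0] := pselect (B = A); first by split.
have nBA z : A z -> ~ B z by move=> Az Bz; rewrite -[False]/(set0 z) -BA0.
by split=> [/(nBA _ Ax)|/(nBA _ Ay)].
Qed.

Fact same_block_equiv : equiv_class_of same_block.
Proof.
have sym x y : same_block x y -> same_block y x.
  by move=> /asboolP e; apply/asboolP => A GA; apply: iff_sym; exact: e.
have trans x y z : same_block x y -> same_block y z -> same_block x z.
  move=> /asboolP xy /asboolP yz; apply/asboolP => A GA.
  exact: iff_trans (xy _ GA) (yz _ GA).
split=> [x|x y|y x z]; [exact/asboolP| |exact: trans].
by apply/idP/idP; exact: sym.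
Qed.

Canonical same_block_equivRel := EquivRelPack same_block_equiv.

Definition quotient_space : topologicalType :=
  quotient_topology {eq_quot same_block}%qT.

Definition quotient_map (x : X) : quotient_space :=
  (\pi_(quotient_topology {eq_quot same_block}%qT) x)%qT.

End Quotient.

Definition monotone_decomposition (X : topologicalType) (G : set (set X)) :=
  decomposition G /\ forall A, G A -> connected A.

Definition usc_decomposition (X : topologicalType) (G : set (set X)) : Prop :=
  [/\ decomposition G, forall A, G A -> closed A
    & closed_map (quotient_map G)].

Definition continuous_decomposition (X : topologicalType)
    (G : set (set X)) : Prop :=
  [/\ decomposition G, closed_map (quotient_map G)
    & open_map (quotient_map G)].

Definition refines (X : Type) (G H : set (set X)) : Prop :=
  forall A, G A -> exists2 B, H B & A `<=` B.

Definition arc_decomposition (R : realType) (X : topologicalType)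
    (G : set (set X)) : Prop :=
  [/\ monotone_decomposition G, usc_decomposition G,
      forall A, G A -> nowhere_dense A & is_arc R (quotient_space G)].

Definition finest_arc_decomposition (R : realType) (X : topologicalType)
    (G : set (set X)) : Prop :=
  arc_decomposition R G /\ forall H, arc_decomposition R H -> refines G H.

(* The finest decomposition is unique: two decompositions refining each other
   are equal. *)
Definition continuously_irreducible (R : realType) (X : topologicalType) :=
  type_lambda X /\
  exists2 G : set (set X),
    finest_arc_decomposition R G & continuous_decomposition G.

Definition hyperspace (R : realType) (X : continuumType R) : Type :=
  {A : set X | closed A /\ A !=set0}.

HB.instance Definition _ (R : realType) (X : continuumType R) :=
  gen_eqMixin (hyperspace X).
HB.instance Definition _ (R : realType) (X : continuumType R) :=
  gen_choiceMixin (hyperspace X).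

Definition thickening (R : realType) (X : metricType R) (r : R) (A : set X) :
  set X := \bigcup_(a in A) ball a r.

Definition hausdorff_radii (R : realType) (X : metricType R) (A B : set X) :
  set R := [set r | 0 < r /\ A `<=` thickening r B /\ B `<=` thickening r A].

Definition hausdorff_dist (R : realType) (X : metricType R) (A B : set X) : R :=
  inf (hausdorff_radii A B).

Section HausdorffMetric.
Context {R : realType} {X : continuumType R}.
Implicit Types A B C : hyperspace X.

Let dist A B : R := hausdorff_dist (sval A) (sval B).

Lemma continuum_bounded : exists2 r : R, 0 < r & forall x y : X, ball x r y.
Proof.
have [p _] := @continuum_nonempty R X.
have /compact_near_coveringP cX := @continuum_compact R X.
have [x _|r [_ pr]] := cX R (pinfty_nbhs R) (fun r => ball p r) _.
  near=> y r => /=; apply: (@le_ball _ _ _ (mdist p x + 1 + 1)).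
    by near: r; apply: nbhs_pinfty_ge; rewrite num_real.
  apply: (@ball_triangle _ _ x); first by rewrite ballEmdist/= ltrDl.
  by near: y; exact: nbhsx_ballx.
have {}pr x : ball p (r + 1) x by apply: pr => //; rewrite ltrDl.
exists (r + 1 + (r + 1)) => [|x y]; last exact: ball_triangle (ball_sym (pr x)) (pr y).
suff r0 : 0 < r + 1 by rewrite addr_gt0.
by have := pr p; rewrite ballEmdist/= mdistxx.
Unshelve. all: by end_near. Qed.

Lemma hausdorff_radii_neq0 A B :
  hausdorff_radii (sval A) (sval B) !=set0.
Proof.
have [r r0 br] := continuum_bounded.
case: A B => [A [_ [a Aa]]] [B [_ [b Bb]]] /=.
by exists r; split => //; split => x _; [exists b|exists a].
Qed.

Lemma hausdorff_radii_has_inf A B :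
  has_inf (hausdorff_radii (sval A) (sval B)).
Proof.
split; first exact: hausdorff_radii_neq0.
by exists 0 => r [/ltW].
Qed.

Lemma hausdorff_dist_ltP A B (e : R) :
  hausdorff_dist (sval A) (sval B) < e ->
  exists2 r, hausdorff_radii (sval A) (sval B) r & r < e.
Proof.
move=> ABe; have e0 : 0 < e - hausdorff_dist (sval A) (sval B).
  by rewrite subr_gt0.
have [r ABr re] := inf_adherent e0 (hausdorff_radii_has_inf A B).
by exists r => //; move: re; rewrite addrC subrK.
Qed.

Lemma hausdorff_dist_le A B (r : R) :
  hausdorff_radii (sval A) (sval B) r ->
  hausdorff_dist (sval A) (sval B) <= r.
Proof. by move=> ABr; apply: ge_inf => //; exists 0 => s [/ltW]. Qed.

Let dist_ge0 A B : 0 <= dist A B.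
Proof. by apply: lb_le_inf; [exact: hausdorff_radii_neq0|move=> r [/ltW]]. Qed.

Let distxx A : dist A A = 0.
Proof.
apply/eqP; rewrite eq_le dist_ge0 andbT; apply/ler_addgt0Pl => e e0.
rewrite addr0; apply: hausdorff_dist_le.
by split => //; split => x Ax; exists x => //; exact: ballxx.
Qed.

Let dist_sym A B : dist A B = dist B A.
Proof.
by rewrite /dist /hausdorff_dist; congr inf; apply/seteqP; split => r [? []].
Qed.

Let dist0_subset A B : dist A B = 0 -> sval A `<=` sval B.
Proof.
move=> AB0 x Ax; case: (svalP B) => cB _; apply: cB => U.
rewrite -nbhs_ballE => -[e /= e0 xeU].
have [|r [r0 [AB _]] re] := @hausdorff_dist_ltP A B e.
  by rewrite -/(dist A B) AB0.
have [b Bb bx] := AB x Ax; exists b; split => //; apply: xeU.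
by apply: le_ball (ball_sym bx); exact: ltW.
Qed.

Let dist_positivity A B : dist A B = 0 -> A = B.
Proof.
move=> AB0; have : sval A = sval B.
  by apply/seteqP; split; apply: dist0_subset; rewrite // dist_sym.
case: A B {AB0} => [A pA] [B pB] /= AB; rewrite -AB in pB *.
by congr exist; exact: Prop_irrelevance.
Qed.

Let dist_triangle B A C : dist A C <= dist A B + dist B C.
Proof.
apply/ler_addgt0Pl => e e0; have e2 : 0 < e / 2 by rewrite divr_gt0.
have [|r [r0 [AB BA]] re] := @hausdorff_dist_ltP A B (dist A B + e / 2).
  by rewrite ltrDl.
have [|s [s0 [BC CB]] se] := @hausdorff_dist_ltP B C (dist B C + e / 2).
  by rewrite ltrDl.
apply: (@le_trans _ _ (r + s)); last first.
  by rewrite [e]splitr addrACA; apply/ltW/ltrD; rewrite addrC.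
apply: hausdorff_dist_le; split; [exact: addr_gt0|split=> [a Aa|c Cc]].
  have [b Bb ba] := AB _ Aa; have [c Cc cb] := BC _ Bb.
  by exists c => //; rewrite [r + s]addrC; exact: ball_triangle cb ba.
have [b Bb bc] := CB _ Cc; have [a Aa ab] := BA _ Bb.
by exists a => //; exact: ball_triangle ab bc.
Qed.

HB.instance Definition _ :=
  isMetric.Build R (hyperspace X) distxx dist_positivity dist_sym dist_triangle.

End HausdorffMetric.

Definition jonesT (X : topologicalType) (A : set X) : set X :=
  ~` [set x | exists W : set X, [/\ subcontinuum W, W° x & W `<=` ~` A]].

Fact jonesT_hyperspace (R : realType) (X : continuumType R)
    (A : hyperspace X) : closed (jonesT (sval A)) /\ jonesT (sval A) !=set0.
Proof.
case: A => [A [cA [a Aa]]] /=; split.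
  apply: open_closedC; rewrite openE => x [W [cW Wx WA]].
  rewrite /interior; apply: filterS (open_nbhs_nbhs (conj (open_interior W) Wx)).
  by move=> y Wy; exists W.
by exists a => -[W [_ /interior_subset Wa /(_ _ Wa)]].
Qed.

Definition jonesT_hyper (R : realType) (X : continuumType R) :
    hyperspace X -> hyperspace X :=
  fun A => exist _ (jonesT (sval A)) (jonesT_hyperspace A).

(* Main.v *)
Require Import Defs.
From HB Require Import structures.
From mathcomp Require Import all_boot all_order all_algebra.
From mathcomp Require Import all_classical all_reals all_analysis.
From mathcomp Require Import lra.
Set Implicit Arguments.
Unset Strict Implicit.
Unset Printing Implicit Defensive.
Import Order.TTheory GRing.Theory Num.Theory.
Import numFieldNormedType.Exports.
Local Open Scope classical_set_scope.
Local Open Scope ring_scope.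

(* Let X be irreducible between p and q, and let z precede x when some
   subcontinuum containing p has z in its interior and misses x.  Irreducibility
   forces T({x}) to be the set of points incomparable with x.  When T is
   continuous, lower semicontinuity at points makes incomparability transitive,
   and a weighted sum of the distances from a dense sequence to the sets
   {y | y does not precede x} is a continuous function of x whose fibres are
   exactly the sets T({x}).  If X is decomposable then p precedes q, so this
   function is onto an arc; its fibres are connected, and lower semicontinuity
   makes it open.  Conversely, for an open monotone map f of X onto [0, 1],
   irreducibility gives T(A) = f^-1(f(A)), which depends continuously on A. *)

(** * Connectedness and separations in topological spaces *)

Section topological.
Context {T : topologicalType}.
Implicit Types A K M U V : set T.

(* A clopen part of [M `|` (K `&` U)] that misses M lies in [K `&` U], hence is clopen in K. *)
Lemma connected_setU_open K M U V :
  connected K -> connected M -> M !=set0 -> M `<=` K -> open U -> open V ->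
  K `<=` M `|` (U `|` V) -> K `&` U `&` V = set0 -> connected (M `|` (K `&` U)).
Proof.
move=> cK cM [m Mm] MK oU oV KMUV UV0.
pose N := M `|` (K `&` U); rewrite -/N; have NK : N `<=` K by move=> x [/MK|[]].
have UVF x : K x -> U x -> V x -> False.
  by move=> Kx Ux Vx; rewrite -[False]/(set0 x) -UV0; split.
have missM D C G : D = N `&` C -> D = N `&` G -> closed C -> open G ->
    (forall x, D x -> ~ M x) -> D = set0.
  move=> DC DG clC opG DM; apply: contrapT => /eqP/set0P D0.
  have DU x : D x -> K x /\ U x.
    by move=> Dx; have := Dx; rewrite DC => -[[/(DM _ Dx)|]].
  suff : D = K by move=> DK; apply: (DM m) => //; rewrite DK; exact: MK.
  apply: cK => //.
    exists (U `&` G); first exact: openI.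
    apply/seteqP; split=> x.
      by move=> Dx; have [Kx Ux] := DU _ Dx; move: Dx; rewrite DG => -[].
    by move=> [Kx [Ux Gx]]; rewrite DG; split => //; right.
  exists (~` V `&` C); first by apply: closedI => //; exact: open_closedC.
  apply/seteqP; split=> x.
    move=> Dx; have [Kx Ux] := DU _ Dx; split=> //; split; first exact: UVF Kx Ux.
    by move: Dx; rewrite DC => -[].
  move=> [Kx [nVx Cx]]; rewrite DC; split => //.
  by have [Mx|[Ux|//]] := KMUV _ Kx; [left|right].
move=> B [b Bb] [G oG BG] [C cC BC].
have [[y [My By]]|MB0] := pselect (M `&` B !=set0); last first.
  suff B0 : B = set0 by move: Bb; rewrite B0.
  by apply: (missM B C G) => // x Bx Mx; apply: MB0; exists x.
have MB : M `<=` B.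
  have <- : M `&` B = M; last by apply: subIset; right.
  apply: cM; [by exists y| |].
    exists G => //; apply/seteqP; split=> x; rewrite BG; first by move=> [? []].
    by move=> [? ?]; split => //; split => //; left.
  exists C => //; apply/seteqP; split=> x; rewrite BC; first by move=> [? []].
  by move=> [? ?]; split => //; split => //; left.
have NB0 : N `\` B = set0.
  apply: (missM _ (~` G) (~` C)).
  - by rewrite setDE BG setCI setIUr setICr set0U.
  - by rewrite setDE BC setCI setIUr setICr set0U.
  - exact: open_closedC.
  - exact: closed_openC.
  - by move=> x [_ Bx] /MB.
apply/seteqP; split=> x; first by rewrite BG => -[].
move=> Nx; apply: contrapT => Bx; rewrite -[False]/(set0 x) -NB0; by split.
Qed.

Lemma open_disconnected A : open A -> ~ connected A ->
  exists U V, [/\ open U, open V, U !=set0, V !=set0 & U `&` V = set0 /\ U `|` V = A].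
Proof.
move=> oA /existsNP[B] /not_implyP[B0] /not_implyP[[G oG BG]] /not_implyP[[C cC BC] BA].
exists (A `&` G), (A `&` ~` C); split.
- exact: openI.
- exact/openI/closed_openC.
- by rewrite -BG.
- apply: contrapT => AC0; apply: BA; rewrite BC; apply/setIidPl => x Ax.
  by apply: contrapT => Cx; apply: AC0; exists x.
- rewrite -BG BC; split; last by rewrite -setIUr setUCr setIT.
  by rewrite setIACA setICr setI0.
Qed.

Lemma closed_disconnected A : closed A -> ~ connected A ->
  exists B C, [/\ closed B, closed C, B !=set0, C !=set0 & B `&` C = set0 /\ B `|` C = A].
Proof.
move=> cA /existsNP[B] /not_implyP[B0] /not_implyP[[G oG BG]] /not_implyP[[C cC BC] BA].
exists (A `&` C), (A `&` ~` G); split.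
- exact: closedI.
- by apply: closedI => //; exact: open_closedC.
- by rewrite -BC.
- apply: contrapT => AG0; apply: BA; rewrite BG; apply/setIidPl => x Ax.
  by apply: contrapT => Gx; apply: AG0; exists x.
- rewrite -BC BG; split; last by rewrite -setIUr setUCr setIT.
  by rewrite setIACA setICr setI0.
Qed.

Lemma connected_sub_open A U V : connected A ->
  open U -> open V -> U `&` V = set0 -> A `<=` U `|` V -> A `&` U !=set0 -> A `<=` U.
Proof.
move=> cA oU oV UV0 AUV AU0; suff <- : A `&` U = A by apply: subIset; right.
apply: cA => //; first by exists U.
exists (~` V); first exact: open_closedC.
apply/seteqP; split=> x [Ax].
  by move=> Ux; split => // Vx; rewrite -[False]/(set0 x) -UV0.
by move=> Vx; split => //; have [|] := AUV x Ax.
Qed.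

Lemma connected_setT_clopen A : connected [set: T] -> open A -> closed A ->
  A !=set0 -> A = [set: T].
Proof. by move=> cT oA cA A0; apply: cT => //; exists A => //; rewrite setTI. Qed.

End topological.

(** * Subcontinua of a continuum *)

Section continuum.
Context {R : realType} {X : continuumType R}.
Implicit Types A K W : set X.

Lemma continuum_closed_compact A : closed A -> compact A.
Proof. by move=> cA; apply: subclosed_compact cA continuum_compact _. Qed.

Lemma compact_closed_continuum A : compact A -> closed A.
Proof. exact: compact_closed (@metric_hausdorff _ X). Qed.

Lemma subcontinuum_closed W : subcontinuum W -> closed W.
Proof. by case=> /compact_closed_continuum. Qed.

Lemma subcontinuum_openC W : subcontinuum W -> open (~` W).
Proof. by move=> /subcontinuum_closed/closed_openC. Qed.

Lemma subcontinuum_nbhsC W x : subcontinuum W -> ~ W x -> nbhs x (~` W).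
Proof. by move=> sW Wx; apply: open_nbhs_nbhs; split => //; exact: subcontinuum_openC. Qed.

Lemma subcontinuumE W : subcontinuum W <-> [/\ closed W, connected W & W !=set0].
Proof.
split=> -[cW ? ?]; split=> //; first exact: compact_closed_continuum.
exact: continuum_closed_compact.
Qed.

Lemma subcontinuum1 (x : X) : subcontinuum [set x].
Proof. by split; [exact: compact_set1|exact: connected1|exists x]. Qed.

Lemma interior_set1 (p q : X) : p <> q -> [set p]° = set0.
Proof.
move=> pq; apply: contrapT => /eqP/set0P[_ /[dup] /interior_subset -> pp].
suff pT : [set p] = [set: X] by have : [set: X] q by []; rewrite -pT => /esym.
apply: connected_setT_clopen; first exact: continuum_connected.
- by rewrite openE => _ ->.
- exact: subcontinuum_closed (subcontinuum1 p).
- by exists p.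
Qed.

Lemma subcontinuumU K W : subcontinuum K -> subcontinuum W -> K `&` W !=set0 ->
  subcontinuum (K `|` W).
Proof.
move=> [cK kK [x Kx]] [cW kW _] KW; split; [exact: compactU|exact: connectedU|].
by exists x; left.
Qed.

Lemma subcontinuum_closure A : connected A -> A !=set0 -> subcontinuum (closure A).
Proof.
move=> cA A0; apply/subcontinuumE; split; [exact: closed_closure|exact: connected_closure|].
by case: A0 => x Ax; exists x; exact: subset_closure.
Qed.

Lemma subcontinuum_setU_open K U V : subcontinuum K -> open U -> open V ->
  U `&` V = set0 -> U `|` V = ~` K -> subcontinuum (K `|` U).
Proof.
move=> sK oU oV UV0 UVK; have [cK kK [k Kk]] := sK; apply/subcontinuumE; split.
- rewrite -[K `|` U]setCK; apply: open_closedC.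
  rewrite (_ : ~` _ = V) //; apply/seteqP; split => x.
    by rewrite setCU -UVK => -[[]].
  move=> Vx [Kx|Ux].
    by have : (~` K) x by rewrite -UVK; right.
  by rewrite -[False]/(set0 x) -UV0.
- rewrite -[U]setTI; apply: (connected_setU_open (V := V)) => //.
  + exact: continuum_connected.
  + by exists k.
  + by rewrite UVK setUCr.
  + by rewrite setTI.
- by exists k; left.
Qed.

End continuum.

(** Lower semicontinuity of the map from x to T({x}): the form in which continuity of T enters the
    construction of the arc. *)
Definition jonesT1_lower_semicontinuous (X : topologicalType) :=
  forall (x z : X) (U : set X), jonesT [set x] z -> nbhs z U ->
    \forall x' \near x, jonesT [set x'] `&` U !=set0.

(** * The order [precedes] of an irreducible continuum *)

Section irreducible_between.
Context {R : realType} {X : continuumType R}.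
Implicit Types (K W M : set X) (p q x y z : X).

Definition irreducible_between p q :=
  forall W, subcontinuum W -> W p -> W q -> W = [set: X].

Definition precedes p z x := exists K, [/\ subcontinuum K, K p, K° z & ~ K x].

Lemma irreducible_betweenP :
  irreducible X <-> exists p q, irreducible_between p q.
Proof.
split=> -[p [q pq]]; exists p, q; last first.
  by move=> [W [sW [_ nW] Wp Wq]]; apply: nW; rewrite (pq W).
move=> W sW Wp Wq; apply: contrapT => WT; apply: pq; exists W; split => //.
by split => // TW; apply: WT; apply/seteqP; split.
Qed.

Lemma irreducible_between_sym p q :
  irreducible_between p q -> irreducible_between q p.
Proof. by move=> pq W sW Wq Wp; exact: pq. Qed.

Lemma precedes_irrefl p x : ~ precedes p x x.
Proof. by move=> [K [_ _ /interior_subset]]. Qed.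

Lemma near_precedes p z x : precedes p z x ->
  \forall z' \near z & x' \near x, precedes p z' x'.
Proof.
move=> [K [sK Kp Kz Kx]]; exists (K°, ~` K) => /=.
  split; first exact: open_nbhs_nbhs (conj (open_interior K) Kz).
  exact: subcontinuum_nbhsC.
by move=> [z' x'] [/= Kz' Kx']; exists K.
Qed.

Lemma open_before p x : open [set y | precedes p y x].
Proof.
rewrite openE => y /(near_precedes)[[A B] [/= Ay Bx] AB].
by apply: filterS Ay => y' Ay'; apply: (AB (y', x)); split => //; exact: nbhs_singleton.
Qed.

Lemma open_after p z : open [set y | precedes p z y].
Proof.
rewrite openE => y /(near_precedes)[[A B] [/= Az By] AB].
by apply: filterS By => y' By'; apply: (AB (z, y')); split => //; exact: nbhs_singleton.
Qed.

(** If the complement of [K] split into two open pieces, [K] with a suitable one of them would be a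
    proper subcontinuum joining [p] to [q]. *)
Lemma connected_setC_subcontinuum p q K : irreducible_between p q ->
  subcontinuum K -> K p -> connected (~` K).
Proof.
move=> pq sK Kp; apply: contrapT.
move=> /(open_disconnected (subcontinuum_openC sK)).
move=> [U [V [oU oV U0 V0 [UV0 UVK]]]].
wlog qU : U V oU oV U0 V0 UV0 UVK / K q \/ U q => [wl|].
  have [Kq|Kq] := pselect (K q); first by apply: (wl U V) => //; left.
  have : (U `|` V) q by rewrite UVK.
  move=> [Uq|Vq]; first by apply: (wl U V) => //; right.
  by apply: (wl V U) => //; rewrite 1?setIC 1?setUC//; right.
have KUT := pq _ (subcontinuum_setU_open sK oU oV UV0 UVK) (or_introl Kp) qU.
case: V0 => v Vv; have : (K `|` U) v by rewrite KUT.
move=> [Kv|Uv]; last by rewrite -[False]/(set0 v) -UV0.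
by have : (~` K) v by rewrite -UVK; right.
Qed.

Section fixed_endpoints.
Variables (p q : X) (pq : irreducible_between p q).

Lemma subcontinuum_closure_setC K x : subcontinuum K -> K p -> ~ K x ->
  subcontinuum (closure (~` K)).
Proof.
move=> sK Kp Kx; apply: subcontinuum_closure; last by exists x.
exact: connected_setC_subcontinuum pq sK Kp.
Qed.

(** The closure of the complement of [K] is a subcontinuum containing [q]; it is a neighbourhood of
    [x] and misses the interior of [K], hence [z]. *)
Lemma precedes_sym_sub z x : precedes p z x -> precedes q x z.
Proof.
move=> [K [sK Kp Kz Kx]].
exists (closure (~` K)); split.
- exact: subcontinuum_closure_setC Kx.
- by apply: subset_closure => Kq; apply: Kx; rewrite (pq sK Kp Kq).
- rewrite /interior; apply: (@filterS _ _ _ (~` K)); first exact: subset_closure.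
  exact: subcontinuum_nbhsC.
- by rewrite closure_setC.
Qed.

(** [K2] meets the closure of the complement of [K1] at [y], so their union is a subcontinuum
    containing [p] and [q], that is, X. As that closure misses the interior of [K1], this interior
    lies in [K2]. *)
Lemma interior_sub K1 K2 y z : subcontinuum K1 -> K1 p -> subcontinuum K2 -> K2 p ->
  ~ K1 y -> K2 y -> K1° z -> K2° z.
Proof.
move=> s1 p1 s2 p2 n1y y2 z1.
have : K2 `|` closure (~` K1) = [set: X].
  apply: pq; last 2 first.
  - by left.
  - by right; apply: subset_closure => Kq; apply: n1y; rewrite (pq s1 p1 Kq).
  apply: subcontinuumU => //; first exact: subcontinuum_closure_setC n1y.
  by exists y; split=> //; exact: subset_closure.
rewrite closure_setC => /seteqP[_ KT2].
suff : K1° `<=` K2 by move=> sub; exact: filterS sub (open_nbhs_nbhs (conj (open_interior _) z1)).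
by move=> w w1; have [//|] := KT2 w I.
Qed.

Lemma precedes_trans x y z : precedes p z y -> precedes p y x -> precedes p z x.
Proof.
move=> [K1 [s1 p1 z1 y1]] [K2 [s2 p2 /interior_subset y2 x2]].
by exists K2; split => //; exact: interior_sub s1 p1 s2 p2 y1 y2 z1.
Qed.

(** Suppose the complement splits into [U] and [V]. If [K] met the closure of [M] with one piece,
    the two would form a subcontinuum joining [p] to [q] and omitting the other piece. So [K] misses
    both closures; they fill its complement, which is thus clopen, against connectedness of X. *)
Lemma connected_setC_disjoint K M : subcontinuum K -> subcontinuum M -> K p -> M q ->
  K `&` M = set0 -> connected (~` (K `|` M)).
Proof.
move=> sK sM Kp Mq KM0; apply: contrapT.
have oKM : open (~` (K `|` M)).
  by rewrite setCU; apply: openI; exact: subcontinuum_openC.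
move=> /(open_disconnected oKM)[U [V [oU oV U0 V0 [UV0 UVK]]]].
have MK : M `<=` ~` K by move=> x Mx Kx; rewrite -[False]/(set0 x) -KM0.
have sub A B : open A -> open B -> A `&` B = set0 -> A `|` B = ~` (K `|` M) ->
    A !=set0 -> B !=set0 -> K `&` closure (M `|` A) = set0.
  move=> oA oB AB0 ABKM [a Aa] [b Bb]; apply: contrapT => /eqP/set0P KMA.
  have AK : ~` K `&` A = A.
    by apply/setIidPr => x Ax; have : (A `|` B) x by [left]; rewrite ABKM setCU => -[].
  have cMA : connected (M `|` A).
    rewrite -AK; apply: (connected_setU_open (V := B)) => //.
    - exact: connected_setC_subcontinuum pq sK Kp.
    - by case: sM.
    - by exists q.
    - by move=> x Kx; rewrite ABKM; have [|Mx] := pselect (M x); [left|right=> -[]].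
    - by rewrite -setIA AB0 setI0.
  have : K `|` closure (M `|` A) = [set: X].
    apply: pq; [|by left|by right; apply: subset_closure; left].
    by apply: subcontinuumU => //; apply: subcontinuum_closure => //; exists a; right.
  have MAB : closure (M `|` A) `<=` ~` B.
    rewrite (iffLR (closure_id (~` B)) (open_closedC oB)); apply: closureS => x MAx Bx.
    have : (A `|` B) x by right.
    rewrite ABKM setCU => -[_ Mx]; case: MAx => // Ax.
    by rewrite -[False]/(set0 x) -AB0.
  move=> /seteqP[_ /(_ b I)[Kb|/MAB //]].
  by have : (A `|` B) b by [right]; rewrite ABKM; apply; left.
have KU := sub _ _ oU oV UV0 UVK U0 V0.
have KV : K `&` closure (M `|` V) = set0 by apply: sub oV oU _ _ V0 U0; rewrite 1?setIC 1?setUC.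
have : closed (closure (M `|` U) `|` closure (M `|` V)) by apply: closedU; exact: closed_closure.
have -> : closure (M `|` U) `|` closure (M `|` V) = ~` K.
  apply/seteqP; split => x.
    by case=> ? Kx; rewrite -[False]/(set0 x); [rewrite -KU|rewrite -KV].
  move=> Kx; have [Mx|Mx] := pselect (M x).
    by left; apply: subset_closure; left.
  have : (U `|` V) x by rewrite UVK => -[].
  by case=> ?; [left|right]; apply: subset_closure; right.
move=> cK; have KT : ~` K = [set: X].
  apply: connected_setT_clopen => //.
  - exact: continuum_connected.
  - exact: subcontinuum_openC.
  - by exists q; exact: MK.
by have : (~` K) p by rewrite KT.
Qed.

End fixed_endpoints.

Section jones.
Variables (p q : X) (pq : irreducible_between p q).

Lemma precedes_sym z x : precedes p z x <-> precedes q x z.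
Proof.
by split; apply: precedes_sym_sub => //; exact: irreducible_between_sym.
Qed.

(** Let [x] and [y] be incomparable and [W] a neighbourhood of [y] missing [x]. Then [W] contains
    neither endpoint, and its complement is disconnected, since otherwise the closure of the
    complement would be a proper subcontinuum joining [p] to [q]. Adding to [W] the piece [U]
    without [x] captures no endpoint either, so [W] with the other piece [V] is a proper
    subcontinuum joining them. *)
Lemma jonesT1P x y : jonesT [set x] y <-> ~ precedes p y x /\ ~ precedes p x y.
Proof.
split=> [Txy|[yx xy]].
  split; first by move=> [K [sK _ Ky Kx]]; apply: Txy; exists K; split => // _ /[swap] ->.
  move=> /precedes_sym [K [sK _ Ky Kx]].
  by apply: Txy; exists K; split => // _ /[swap] ->.
move=> [W [sW Wy /(_ x)]] => Wx; have {}Wx : ~ W x by move=> /Wx; exact.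
have ends K : subcontinuum K -> K° y -> ~ K x -> ~ K p /\ ~ K q.
  move=> sK Ky Kx; split=> [Kp|Kq]; first by apply: yx; exists K.
  by apply: xy; apply/precedes_sym; exists K.
have [Wp Wq] := ends _ sW Wy Wx.
have : ~ connected (~` W).
  move=> /subcontinuum_closure => /(_ (ex_intro _ x Wx)) sC.
  have : closure (~` W) = [set: X] by apply: pq => //; exact: subset_closure.
  by rewrite closure_setC => /seteqP[_ /(_ y I)].
move=> /(open_disconnected (subcontinuum_openC sW))[U [V [oU oV U0 V0 [UV0 UVW]]]].
wlog Vx : U V oU oV U0 V0 UV0 UVW / V x => [wl|].
  have : (U `|` V) x by rewrite UVW.
  move=> [Ux|Vx]; last exact: (wl U V).
  by apply: (wl V U) => //; rewrite 1?setIC 1?setUC.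
have sU := subcontinuum_setU_open sW oU oV UV0 UVW.
have [] := ends _ sU.
- by apply: filterS Wy => z Wz; left.
- by move=> [//|Ux]; rewrite -[False]/(set0 x) -UV0.
move=> WUp WUq.
have inV z : ~ W z -> ~ (W `|` U) z -> V z.
  move=> Wz WUz; have [Uz|//] : (U `|` V) z by rewrite UVW.
  by case: WUz; right.
have : W `|` V = [set: X].
  apply: pq; [|by right; exact: inV|by right; exact: inV].
  by apply: subcontinuum_setU_open oV oU _ _; rewrite 1?setIC 1?setUC.
case: U0 => u Uu /seteqP[_ /(_ u I)[Wu|Vu]].
  by have : (~` W) u by rewrite -UVW; left.
by rewrite -[False]/(set0 u) -UV0.
Qed.

Section lower_semicontinuous.
Hypothesis lscT : jonesT1_lower_semicontinuous X.

(** If this failed, [z] would lie in T({y}) and [y] in the closure of the complement of [K]. Lower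
    semicontinuity then yields [y'] outside [K] and [z'] in T({y'}) interior to [K], so [z']
    precedes [y'], a contradiction. *)
Lemma precedes_split z x y : precedes p z x -> precedes p z y \/ precedes p y x.
Proof.
move=> [K [sK Kp Kz Kx]].
have [zy|zy] := pselect (precedes p z y); first by left.
have [yx|yx] := pselect (precedes p y x); first by right.
have Ky : ~ K° y by move=> Ky; apply: yx; exists K.
have Tyz : jonesT [set y] z.
  apply/jonesT1P; split => // yz; apply: yx; apply: (precedes_trans pq yz).
  by exists K.
have nK : nbhs z K° by apply: open_nbhs_nbhs; split => //; exact: open_interior.
have : closure (~` K) y by rewrite closure_setC.
move=> /(_ _ (lscT Tyz nK))[y' [Ky' [z' [/jonesT1P[+ _] Kz']]]].
by case; exists K.
Qed.

(** If nothing lay between, the open sets of points after [z] and of points before [x] would be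
    disjoint; they cover X by [precedes_split], against connectedness. *)
Lemma precedes_dense z x : precedes p z x -> exists U : set X,
  [/\ open U, U !=set0 & forall y, U y -> precedes p z y /\ precedes p y x].
Proof.
move=> zx.
have oL := open_before p x; have oR := open_after p z.
exists ([set y | precedes p z y] `&` [set y | precedes p y x]); split => //.
  exact: openI.
apply: contrapT => RL0; have LT : [set y | precedes p y x] = [set: X].
  apply: connected_setT_clopen => //; [exact: continuum_connected| |by exists z].
  rewrite (_ : [set y | precedes p y x] = ~` [set y | precedes p z y]).
    exact: open_closedC.
  apply/seteqP; split => y /=.
    by move=> yx zy; apply: RL0; exists y.
  by have [|] := precedes_split y zx.
by apply: (@precedes_irrefl p x); have : [set: X] x by []; rewrite -LT.
Qed.

End lower_semicontinuous.
End jones.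
End irreducible_between.

(** * Weighted sums, distances to sets, dense sequences *)

Lemma strictly_monotone_mixture (R : realType) (T : topologicalType)
    (g : nat -> T -> R) (M : R) :
  (forall n, continuous (g n)) -> (forall n x, 0 <= g n x <= M) ->
  exists f : T -> R, [/\ continuous f,
    forall x y, (forall n, g n x <= g n y) -> f x <= f y &
    forall n x y, (forall n, g n x <= g n y) -> g n x < g n y -> f x < f y].
Proof.
move=> cg g0M.
(* [f] will be the sum of the series of [a n * g n], taken as the supremum of its increasing partial
   sums [S]. *)
pose a n : R := 2^-1 ^+ n.
have a0 n : 0 < a n by rewrite exprn_gt0.
pose S n x := \sum_(i < n) a i * g i x.
have SS n x : S n.+1 x = S n x + a n * g n x by rewrite /S big_ord_recr.
(* The weights from index [n] up to, not including, [n + k] add up to [2 * (a n - a (n + k))]; the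
   tail bound is uniform in [x]. *)
have SD n x k : S n x <= S (n + k)%N x <= S n x + M * 2 * (a n - a (n + k)%N).
  elim: k => [|k /andP[IH1 IH2]]; first by rewrite addn0 subrr mulr0 addr0 lexx.
  rewrite addnS SS; have /andP[g0 gM] := g0M (n + k)%N x.
  have -> : a (n + k).+1 = a (n + k)%N / 2 by rewrite /a exprS mulrC.
  move: (a0 (n + k)%N) IH1 IH2; set b := a (n + k)%N; set c := S (n + k)%N x => b0.
  move=> IH1 IH2; rewrite ler_wpDr ?mulr_ge0 ?(ltW b0)//=; nra.
have Sle n m x : (n <= m)%N -> S n x <= S m x.
  by move=> /subnKC <-; case/andP: (SD n x (m - n)%N).
have SleM n m x : S m x <= S n x + M * 2 * a n.
  have M0 : 0 <= M by have /andP[/le_trans] := g0M 0%N x; exact.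
  have [nm|/ltnW mn] := leqP n m.
    have /andP[_] := SD n x (m - n)%N; rewrite subnKC// => /le_trans; apply.
    by rewrite lerD2l ler_wpM2l ?mulr_ge0// gerBl ltW.
  by rewrite (le_trans (Sle _ _ _ mn))// lerDl !mulr_ge0// ltW.
pose E x := range (S^~ x); pose f x := sup (E x).
have supE x : has_sup (E x).
  split; first by exists (S 0%N x), 0%N.
  by exists (S 0%N x + M * 2 * a 0%N) => _ [m _ <-].
have Sf n x : S n x <= f x by apply: sup_upper_bound => //; exists n.
have fS n x : f x <= S n x + M * 2 * a n.
  by apply: ge_sup; [by exists (S 0%N x), 0%N|move=> _ [m _ <-]].
have fleS x y c : (forall n, S n x + c <= f y) -> f x + c <= f y.
  move=> h; rewrite -lerBrDr; apply: ge_sup; first by exists (S 0%N x), 0%N.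
  by move=> _ [n _ <-]; rewrite lerBrDr.
have Sxy x y n : (forall n, g n x <= g n y) -> S n x <= S n y.
  by move=> xy; apply: ler_sum => i _; rewrite ler_wpM2l// ltW.
exists f; split.
- move=> x; apply/cvgrPdist_lt => e e0.
  have M0 : 0 <= M by have /andP[/le_trans] := g0M 0%N x; exact.
  have [n ne] : exists n, M * 2 * a n < e / 3.
    have h1 : `|2^-1| < 1 :> R by rewrite gtr0_norm// invf_lt1// ltr1n.
    have /cvgrPdist_lt /(_ (e / 3)) := cvg_geometric (M * 2) h1.
    rewrite divr_gt0// => /(_ isT)[n _ /(_ n (leqnn n))] /=.
    by rewrite sub0r normrN => /ltr_normlW; exists n.
  have cS : {for x, continuous (S n)}.
    elim: (n) => [|m IH].
      by rewrite (_ : S 0%N = cst 0) ?funeqE => [|y]; [exact: cvg_cst|rewrite /S big_ord0].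
    rewrite (_ : S m.+1 = S m \+ (fun y => a m * g m y)) ?funeqE => [|y]; last exact: SS.
    by apply: cvgD => //; apply: cvgM; [exact: cvg_cst|exact: cg].
  have /cvgrPdist_lt /(_ (e / 3)) := cS.
  rewrite divr_gt0// => /(_ isT); apply: filterS => y.
  have := Sf n x; have := Sf n y; have := fS n x; have := fS n y.
  rewrite !ltr_norml => *; lra.
- move=> x y xy; have := @fleS x y 0; rewrite !addr0; apply => n.
  by rewrite addr0 (le_trans (Sxy _ _ n xy)).
(* The gain at index [n] persists in every partial sum with more than [n] terms, hence in the
   supremum. *)
- move=> n x y xy nxy; apply: (@lt_le_trans _ _ (f x + a n * (g n y - g n x))).
    by rewrite ltrDl mulr_gt0// subr_gt0.
  apply: fleS => m; apply: le_trans (Sf (n.+1 + m)%N y).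
  apply: le_trans (_ : S (n.+1 + m)%N x + a n * (g n y - g n x) <= _).
    by rewrite lerD2r Sle// leq_addl.
  elim: m => [|m IH]; last first.
    rewrite addnS; move: (n.+1 + m)%N IH => N IH; rewrite !SS.
    have := ler_wpM2l (ltW (a0 N)) (xy N); lra.
  rewrite addn0 !SS; have := Sxy x y n xy; lra.
Qed.

Section set_distance.
Context {R : realType} {X : metricType R}.
Implicit Types (A : set X) (x y d : X).

Definition set_dist d A : R := inf [set mdist d y | y in A].

Lemma set_dist_ltP d A c : A !=set0 -> set_dist d A < c <-> exists2 y, A y & mdist d y < c.
Proof.
move=> A0; have DA : [set mdist d y | y in A] !=set0 by exact: image_nonempty.
split=> [/(inf_lt DA)[_ [y Ay <-] yc]|[y Ay]]; first by exists y.
by apply: le_lt_trans; apply: ge_inf; [exists 0 => _ [z _ <-]; exact: mdist_ge0|exists y].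
Qed.

Lemma set_dist_geP d A c : A !=set0 -> c <= set_dist d A <-> forall y, A y -> c <= mdist d y.
Proof.
move=> A0; split=> [cA y Ay|cA].
  rewrite leNgt; apply/negP => yc; have : set_dist d A < c by apply/set_dist_ltP => //; exists y.
  by rewrite ltNge cA.
by rewrite leNgt; apply/negP => /set_dist_ltP[//|y /cA]; rewrite leNgt => /negP.
Qed.

End set_distance.

(** A point is chosen in each member of a countable base, indexed by an injective code [h]; [x0] is
    the value at numbers that code no nonempty member, and it also makes X a pointed space. *)
Lemma dense_sequence (R : realType) (X : continuumType R) :
  exists d : nat -> X, forall U : set X, open U -> U !=set0 -> exists n, U (d n).
Proof.
have [x0 _] := @continuum_nonempty R X.
pose P : pseudoPMetricType R := HB.pack (X : Type) (PseudoMetric.on X) (isPointed.Build X x0).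
have [B /countable_injP[h hB] [oB bB]] :=
  @compact_second_countable R P (@continuum_compact R X).
exists (fun n => xget x0 [set x | exists2 V, B V /\ h V = n & V x]) => U oU [u Uu].
have [V [BV Vu VU]] := bB u U (open_nbhs_nbhs (conj oU Uu)).
exists (h V); have := @xgetPex X x0 [set x | exists2 W, B W /\ h W = h V & W x].
case; first by exists u, V => //; exact: nbhs_singleton Vu.
by move=> W [BW /hB]; rewrite !inE => /(_ BW BV) -> /VU.
Qed.

(** * A continuous function representing [precedes] *)

Section utility.
Context {R : realType} {X : continuumType R} (p q : X).
Hypothesis pq : irreducible_between p q.
Hypothesis lscT : jonesT1_lower_semicontinuous X.

Let after x := [set y | ~ precedes p y x].

Let after0 x : after x !=set0. Proof. by exists x; exact: precedes_irrefl. Qed.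

(** Upper bound near [x]: a nearly closest [y] still serves for [x'] if [x] precedes [y]; otherwise
    [y] lies in T({x}) and lower semicontinuity supplies a substitute. Lower bound: [precedes] is
    open, and compactness makes the choice of [x'] uniform in [y]. *)
Lemma continuous_set_dist_precedes d : continuous (fun x => set_dist d (after x)).
Proof.
move=> x; set c := set_dist d (after x); apply/cvgrPdist_lt => e e0.
have up : \forall x' \near x, set_dist d (after x') < c + e.
  have /set_dist_ltP[//|y yx yc] : c < c + e by rewrite ltrDl.
  have [xy|xy] := pselect (precedes p x y).
    have nx : nbhs x [set x' | precedes p x' y].
      by apply: open_nbhs_nbhs; split => //; exact: open_before.
    apply: filterS nx => x' xy'; apply/set_dist_ltP => //; exists y => // yx'.
    exact: (@precedes_irrefl _ _ p x' (precedes_trans pq xy' yx')).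
  have Txy : jonesT [set x] y by apply/(jonesT1P pq).
  have nU : nbhs y (ball y (c + e - mdist d y)) by apply: nbhsx_ballx; rewrite subr_gt0.
  apply: filterS (lscT Txy nU) => x' [z [/(jonesT1P pq)[zx' _]]].
  rewrite ballEmdist /= ltrBrDl => yz; apply/set_dist_ltP => //; exists z => //.
  exact: le_lt_trans (metric_triangle _ y _) yz.
have low : \forall x' \near x, c - e / 2 <= set_dist d (after x').
  have /compact_near_coveringP cX := @continuum_compact R X.
  have near_le : \forall x' \near x, [set: X] `<=`
      (fun y => mdist d y < c - e / 2 -> precedes p y x').
    apply: cX => y _; have [yc|cy] := ltP (mdist d y) c.
      have yx : precedes p y x.
        apply: contrapT => yx; have /set_dist_geP : c <= set_dist d (after x) by [].
        by move=> /(_ (after0 x) y yx); rewrite leNgt yc.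
      by apply: filterS (near_precedes yx) => -[].
    exists (ball y (e / 2), setT) => /=.
      by split; [apply: nbhsx_ballx; rewrite divr_gt0|exact: filterT].
    move=> [y' x'] [/= yy' _] dy'; exfalso; move: yy'; rewrite ballEmdist /= => yy'.
    have := metric_triangle d y' y; rewrite (metric_sym y' y); lra.
  apply: filterS near_le => x' h; apply/set_dist_geP => // y yx'.
  by rewrite leNgt; apply/negP => /(h y I).
apply: filterS2 up low => x' hu hl; rewrite ltr_norml; apply/andP; split; lra.
Qed.

Lemma exists_utility : exists2 f : X -> R, continuous f &
  forall z x, precedes p z x <-> f z < f x.
Proof.
have [d dd] := dense_sequence X.
have [r r0 br] := @continuum_bounded R X.
have ge0 n x : 0 <= set_dist (d n) (after x).
  by apply/set_dist_geP => // y _; exact: mdist_ge0.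
have [|n x|f [cf fle flt]] :=
    @strictly_monotone_mixture R X (fun n x => set_dist (d n) (after x)) r.
- by move=> n; exact: continuous_set_dist_precedes.
- rewrite ge0; apply/ltW/set_dist_ltP => //; exists x; first exact: precedes_irrefl.
  by have := br (d n) x; rewrite ballEmdist.
have le z x n : (forall y, precedes p y z -> precedes p y x) ->
    set_dist (d n) (after z) <= set_dist (d n) (after x).
  move=> zx; apply/set_dist_geP => // y yx.
  have /set_dist_geP := lexx (set_dist (d n) (after z)).
  by apply => // yz; apply: yx; exact: zx.
have lt z x : precedes p z x -> f z < f x.
  move=> zx; have [U [oU U0 Uzx]] := precedes_dense pq lscT zx.
  have [n Un] := dd _ oU U0; apply: (flt n) => [m|].
    by apply: le => y yz; exact: (precedes_trans pq yz zx).
  (* [d n] does not precede [z], so its distance to [after z] is zero, while a whole ball around it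
     precedes [x]. *)
  have [zn nx] := Uzx _ Un.
  have [e /= e0 ex] : nbhs_ball (d n) [set y | precedes p y x].
    by rewrite nbhs_ballE; apply: open_nbhs_nbhs; split => //; exact: open_before.
  apply: (@lt_le_trans _ _ e).
    apply/set_dist_ltP => //; exists (d n); last by rewrite mdistxx.
    by move=> nz; exact: (@precedes_irrefl _ _ p z (precedes_trans pq zn nz)).
  apply/set_dist_geP => // y yx; rewrite leNgt; apply/negP => ye; apply: yx.
  by apply: ex; rewrite ballEmdist.
exists f => // z x; split=> [|fzx]; first exact: lt.
(* When [z] does not precede [x], [precedes_split] shows that every point before [x] is before
   [z]. *)
apply: contrapT => zx; move: fzx; rewrite ltNge => /negP; apply.
apply: fle => n; apply: le => y yx.
by have [|/zx] := precedes_split pq lscT z yx.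
Qed.

End utility.

(** * Connectedness of the sets T({x}) *)

Section connected_blocks.
Context {R : realType} {X : continuumType R}.
Hypothesis lscT : jonesT1_lower_semicontinuous X.

(** The utility attains its maximum over [C] at a point before [x], and a subcontinuum reaching
    slightly beyond that point engulfs [C]. The alternative [K = [set p]] covers an empty [C], where
    [x] may be [p]. *)
Lemma subcontinuum_interior_nbhs p q (pq : irreducible_between p q) (x : X) (C : set X) :
  closed C -> (forall y, C y -> precedes p y x) -> exists K,
  [/\ subcontinuum K, K p, C `<=` K° & ~ K x \/ K = [set p]].
Proof.
move=> cC Cx; have [C0|/set0P C0] := eqVneq C set0.
  exists [set p]; split => //; [exact: subcontinuum1|by rewrite C0|by right].
have [f cf fP] := exists_utility pq lscT.
have [z] := compact_EVT_max C0 (continuum_closed_compact cC) (continuous_subspaceT cf).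
rewrite inE => /Cx zx fz.
have [U [_ [y Uy] /(_ _ Uy)[/fP zy [K [sK Kp Ky Kx]]]]] := precedes_dense pq lscT zx.
exists K; split => //; last by left.
move=> w Cw; have [K1 [s1 p1 w1 y1]] : precedes p w y.
  by apply/fP; apply: le_lt_trans zy; apply: fz; rewrite inE.
exact: (interior_sub pq s1 p1 sK Kp y1 (interior_subset Ky)).
Qed.

(** Separate two closed pieces of T({x}) by open [U] and [V]. The points outside [U] and [V] are
    comparable with [x]; those before it are enclosed in a [K] around [p], those after it in an [M]
    around [q]. The closure of the complement of [K] and [M] is connected, contains T({x}) and is
    covered by [U] and [V], which is impossible. *)
Lemma connected_jonesT1 (p q : X) (pq : irreducible_between p q) (x : X) :
  p <> q -> connected (jonesT [set x]).
Proof.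
move=> pNq; set F := jonesT _; apply: contrapT.
have qp := irreducible_between_sym pq.
have cF : closed F.
  have c1 : closed [set x] by exact: subcontinuum_closed (subcontinuum1 x).
  have h1 : [set x] !=set0 by exists x.
  by have [] := jonesT_hyperspace (exist _ [set x] (conj c1 h1)).
move=> /(closed_disconnected cF)[A [B [cA cB [a Aa] [b Bb] [AB0 ABF]]]].
have /(@normal_openP R _) := compact_normal (@metric_hausdorff _ X) (@continuum_compact R X).
move=> /(_ A B cA cB AB0)[U [V [oU oV AU BV UV0]]].
pose E := ~` (U `|` V); have cE : closed E by apply: open_closedC; exact: openU.
have ltx y : E y -> precedes p y x \/ precedes p x y.
  move=> Ey; apply: contrapT => /not_orP yx; apply: Ey.
  have : F y by apply/(jonesT1P pq).
  by rewrite -ABF => -[/AU|/BV]; [left|right].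
(* On [E] every point is comparable with [x], so not following [x] means preceding it; the negative
   form gives a closed set. *)
have [|y [Ey xy]|K [sK Kp CK Kx]] :=
    @subcontinuum_interior_nbhs p q pq x (E `&` [set y | ~ precedes p x y]).
- apply: closedI => //; apply: open_closedC; exact: open_after.
- by have [] := ltx _ Ey.
have [|y [Ey xy]|M [sM Mq CM Mx]] :=
    @subcontinuum_interior_nbhs q p qp x (E `&` [set y | ~ precedes p y x]).
- apply: closedI => //; apply: open_closedC; exact: open_before.
- by have [|/(precedes_sym pq)] := ltx _ Ey.
have KM0 : K `&` M = set0.
  apply: contrapT => /eqP/set0P [y [Ky My]].
  case: Kx Mx => [Kx|K1] [Mx|M1].
  - have : K `|` M = [set: X].
      by apply: pq; [apply: subcontinuumU => //; exists y|left|right].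
    by move=> /seteqP[_ /(_ x I)[]].
  - by move: My; rewrite M1 => yq; apply: Kx; rewrite (pq K) // -yq.
  - by move: Ky; rewrite K1 => yp; apply: Mx; rewrite (pq M) // -yp.
  - by move: Ky My; rewrite K1 M1 => -> ?; exact: pNq.
(* A point interior to the union is interior to [K] or to [M], as these are disjoint and closed, so
   it is comparable with [x]; singletons have empty interior. *)
have FC : F `<=` closure (~` (K `|` M)).
  move=> y /(jonesT1P pq)[yx xy]; rewrite closure_setC => KMy.
  have [Ky|My] := interior_subset KMy.
    have Kiy : K° y.
      have My : ~ M y by move=> My; rewrite -[False]/(set0 y) -KM0.
      by apply: filterS2 KMy (subcontinuum_nbhsC sM My) => z [].
    case: Kx => [Kx|K1]; first by apply: yx; exists K.
    by move: Kiy; rewrite K1 (interior_set1 pNq).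
  have Miy : M° y.
    have Ky : ~ K y by move=> Ky; rewrite -[False]/(set0 y) -KM0.
    by apply: filterS2 KMy (subcontinuum_nbhsC sK Ky) => z [].
  case: Mx => [Mx|M1]; first by apply: xy; apply/(precedes_sym pq); exists M.
  by move: Miy; rewrite M1 (interior_set1 (nesym pNq)).
have CUV : closure (~` (K `|` M)) `<=` U `|` V.
  move=> y; rewrite closure_setC => KMy; apply: contrapT => Ey; apply: KMy.
  have [yx|xy] := ltx _ Ey.
    have : K° y.
      apply: CK; split=> // xy; exact: precedes_irrefl (precedes_trans pq yx xy).
    by apply: filterS => z; left.
  have : M° y.
    apply: CM; split=> // yx; exact: precedes_irrefl (precedes_trans pq yx xy).
  by apply: filterS => z; right.
have /connected_closure cC := connected_setC_disjoint pq sK sM Kp Mq KM0.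
have Fa : F a by rewrite -ABF; left.
have Fb : F b by rewrite -ABF; right.
have Ub : U b.
  apply: (connected_sub_open cC oU oV UV0 CUV) (FC _ Fb).
  by exists a; split; [exact: FC|exact: AU].
by rewrite -[False]/(set0 b) -UV0; split => //; exact: BV.
Qed.

End connected_blocks.

(** * Arc maps, the real-valued form of the quotient maps of arc decompositions *)

Definition arc_map (R : realType) (X : topologicalType) (f : X -> R) :=
  [/\ continuous f, range f = `[0, 1]%classic,
      forall t, connected (f @^-1` [set t]) & forall t, (f @^-1` [set t])° = set0].

Definition fibres (X Y : Type) (f : X -> Y) : set (set X) :=
  [set f @^-1` [set f x] | x in [set: X]].

(** Openness of the quotient map onto the fibres, read in X: the image of an open set under an arc
    map need not be open in the real line. *)
Definition saturated_open (X : topologicalType) (Y : Type) (f : X -> Y) :=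
  forall U : set X, open U -> open (f @^-1` (f @` U)).

Lemma quotient_mapP (X : topologicalType) (G : set (set X)) (x y : X) :
  quotient_map G x = quotient_map G y <-> same_block G x y.
Proof.
have e : reflect (quotient_map G x = quotient_map G y) (same_block G x y).
  exact: (@eqmodP _ (same_block_equivRel G)).
by split=> /e.
Qed.

Lemma decomposition_block (X : Type) (G : set (set X)) (x : X) :
  decomposition G -> exists2 A, G A & A x.
Proof. by move=> [_ _ GT]; have : [set: X] x by []; rewrite -GT => -[A]; exists A. Qed.

Lemma arc_decomposition_map (R : realType) (X : topologicalType) (G : set (set X)) :
  arc_decomposition R G -> exists2 f : X -> R, arc_map f &
    forall x y, f x = f y <-> quotient_map G x = quotient_map G y.
Proof.
move=> [[dG connG] [_ clG _] nd [h [k [ch ck hK kH]]]].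
pose f x := set_val (h (quotient_map G x)).
have fP x y : f x = f y <-> quotient_map G x = quotient_map G y.
  split=> [fxy|xy]; last by rewrite /f xy.
  by apply: (can_inj hK); exact: val_inj.
have fib t : f @^-1` [set t] = set0 \/ G (f @^-1` [set t]).
  have [[x <-]|ft] := pselect (exists x, f x = t); last first.
    by left; rewrite -subset0 => x fx; apply: ft; exists x.
  right; have [A GA Ax] := decomposition_block x dG; suff -> : f @^-1` [set f x] = A by [].
  apply/seteqP; split=> y.
    by move=> /esym/fP/quotient_mapP/(same_blockP _ dG GA Ax).
  by move=> Ay; apply/esym/fP/quotient_mapP/(same_blockP _ dG GA Ax).
exists f => //; split.
- move=> x; apply: (@continuous_comp X (quotient_space G) R (quotient_map G) (set_val \o h)).
    exact: pi_continuous.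
  apply: (@continuous_comp _ _ R h set_val); first exact: ch.
  exact: initial_continuous.
- apply/seteqP; split=> [_ [x _ <-]|t t01]; first exact: set_valP.
  exists (repr (k (SigSub (mem_set t01)))) => //.
  by rewrite /f /quotient_map reprK kH.
- by move=> t; have [->|/connG//] := fib t; exact: connected0.
- move=> t; have [->|Gt] := fib t; first exact: interior0.
  by have := nd _ Gt; rewrite /nowhere_dense -(closure_id _).1//; exact: clG.
Qed.

Section arc_map_decomposition.
Context {R : realType} {X : continuumType R} (f : X -> R).
Hypothesis arcf : arc_map f.

Let G := fibres f.

Lemma decomposition_fibres : decomposition G.
Proof.
split=> [A [x _ <-]|A B [x _ <-] [y _ <-] AB|]; first by exists x.
  rewrite -subset0 => z [/= zx zy]; apply: AB; congr (_ @^-1` [set _]).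
  by rewrite -zx.
by apply/seteqP; split=> // x _; exists (f @^-1` [set f x]) => //; exists x.
Qed.

Lemma same_block_fibres x y : same_block G x y <-> f x = f y.
Proof.
have Gx : G (f @^-1` [set f x]) by exists x.
split=> [/(same_blockP _ decomposition_fibres Gx (erefl _)) //|fxy].
by apply/(same_blockP _ decomposition_fibres Gx (erefl _)).
Qed.

Lemma quotient_map_fibres x y : quotient_map G x = quotient_map G y <-> f x = f y.
Proof. by rewrite quotient_mapP same_block_fibres. Qed.

Lemma image_quotient_map_fibres (A : set X) :
  quotient_map G @^-1` (quotient_map G @` A) = f @^-1` (f @` A).
Proof. by apply/seteqP; split=> x [y Ay /quotient_map_fibres ?]; exists y. Qed.

Lemma closed_image A : closed A -> closed (f @` A).
Proof.
case: arcf => cf _ _ _ /continuum_closed_compact cA.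
apply: compact_closed; first exact: Rhausdorff.
by apply: continuous_compact cA; exact: continuous_subspaceT.
Qed.

Lemma closed_map_fibres : closed_map (quotient_map G).
Proof.
move=> A /closed_image cA; rewrite -openC.
rewrite /open /= /quotient_open.
rewrite -[X in open X]/(~` (quotient_map G @^-1` (quotient_map G @` A))).
rewrite openC image_quotient_map_fibres.
by apply: closed_comp cA => x _; case: arcf => + _ _ _; exact.
Qed.

Lemma open_map_fibres : saturated_open f -> open_map (quotient_map G).
Proof.
move=> so U /so; by rewrite -image_quotient_map_fibres; exact.
Qed.

Lemma is_arc_fibres : is_arc R (quotient_space G).
Proof.
have [cf rf _ _] := arcf.
have f01 x : f x \in `[0, 1]%classic by rewrite inE -rf; exists x.
pose u x : set_type `[0, 1]%classic := SigSub (f01 x).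
have fK (t : set_type `[0, 1]%classic) : exists x, f x = set_val t.
  have : range f (set_val t) by rewrite rf; exact: set_valP.
  by move=> [x _]; exists x.
pose v t := projT1 (cid (fK t)); have vK t : f (v t) = set_val t by rewrite /v; case: cid.
have reprf x : f (repr (quotient_map G x)) = f x by apply/quotient_map_fibres; exact: reprK.
exists (u \o repr : quotient_space G -> _), (quotient_map G \o v); split.
- apply: repr_comp_continuous; first by apply: continuous_comp_initial; exact: cf.
  by move=> x y /eqP/quotient_map_fibres fxy; apply/eqP/val_inj.
(* Continuity of the inverse comes from [f] being a closed map. *)
- apply/continuousP => V oV; exists (~` (f @` (quotient_map G @^-1` (~` V)))).
    apply: closed_openC; apply: closed_image; rewrite preimage_setC; apply: open_closedC.
    by move/continuousP: (@pi_continuous X {eq_quot same_block G}%qT); apply.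
  apply/seteqP; split=> t /= Vt.
    by apply: contrapT => nVt; apply: Vt; exists (v t).
  by move=> [x + fx]; apply; rewrite (_ : quotient_map G x = quotient_map G (v t)) //;
    apply/quotient_map_fibres; rewrite vK.
- move=> z; rewrite -[RHS]reprK; apply/quotient_map_fibres.
  by rewrite vK.
- by move=> t; apply: val_inj; rewrite /= reprf vK.
Qed.

Lemma arc_decomposition_fibres : arc_decomposition R G.
Proof.
have [cf _ connf f0] := arcf.
have clG A : G A -> closed A.
  by case=> x _ <-; apply: closed_comp => [y _|]; [exact: cf|exact: closed_eq].
split.
- by split; [exact: decomposition_fibres|move=> A [x _ <-]].
- by split; [exact: decomposition_fibres|exact: clG|exact: closed_map_fibres].
- move=> A GA; rewrite /nowhere_dense -(closure_id _).1; last exact: clG.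
  by case: GA => x _ <-.
- exact: is_arc_fibres.
Qed.

End arc_map_decomposition.

(** * Arc maps on irreducible continua and the values of T *)

Section arc_map_theory.
Context {R : realType} {X : continuumType R} (f : X -> R).
Hypothesis arcf : arc_map f.

Let cf : continuous f. Proof. by case: arcf. Qed.

Let f01 x : 0 <= f x <= 1.
Proof.
have [_ rf _ _] := arcf; have : range f (f x) by exists x.
by rewrite rf /= in_itv.
Qed.

Let f_surj t : 0 <= t <= 1 -> exists x, f x = t.
Proof.
have [_ rf _ _] := arcf => t01; have : range f t by rewrite rf /= in_itv.
by case=> x _ <-; exists x.
Qed.

(** Each fibre is connected, so it lies in one piece of a separation of the preimage; the images of
    the pieces are then disjoint, closed by compactness, and would separate [C]. *)
Lemma connected_preimage (C : set R) : closed C -> connected C -> C `<=` `[0, 1]%classic ->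
  connected (f @^-1` C).
Proof.
move=> clC cC C01; have [_ _ connf _] := arcf; apply: contrapT.
have clfC : closed (f @^-1` C) by apply: closed_comp clC => x _; exact: cf.
move=> /(closed_disconnected clfC)[A [B [cA cB [a Aa] [b Bb] [AB0 ABC]]]].
have disj x y : A x -> B y -> f x = f y -> False.
  move=> Ax By fxy; have fibAB : f @^-1` [set f x] `<=` A `|` B.
    have Cx : (f @^-1` C) x by rewrite -ABC; left.
    by move=> z fz; rewrite ABC /preimage /= fz.
  suff : f @^-1` [set f x] `&` A = f @^-1` [set f x].
    by move=> /seteqP[_ /(_ y (esym fxy))[_ Ay]]; rewrite -[False]/(set0 y) -AB0.
  apply: (connf (f x)); first by exists x.
    exists (~` B); first exact: closed_openC.
    apply/seteqP; split=> z [fz Az]; split=> //; first by move=> Bz; rewrite -[False]/(set0 z) -AB0.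
    by have [] := fibAB _ fz.
  by exists A.
have CE x : (A `|` B) x -> C (f x) by rewrite ABC.
have : f @` A = C.
  apply: cC; first by exists (f a), a.
    exists (~` (f @` B)); first exact/closed_openC/(closed_image arcf).
    apply/seteqP; split=> [_ [x Ax <-]|t [Ct fBt]].
      split; first by apply: CE; left.
      by move=> [y By /esym]; exact: disj.
    have [x fx] := f_surj (C01 _ Ct); exists x => //.
    have : (A `|` B) x by rewrite ABC /= fx.
    by case=> // Bx; exfalso; apply: fBt; exists x.
  exists (f @` A); first exact: (closed_image arcf).
  by apply/esym/setIidPr => _ [x Ax <-]; apply: CE; left.
by move=> /seteqP[_ /(_ (f b))[]]; [apply: CE; right|move=> x Ax /disj; exact].
Qed.

Lemma subcontinuum_preimage_itv s t : 0 <= s -> s <= t -> t <= 1 ->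
  subcontinuum (f @^-1` `[s, t]%classic).
Proof.
move=> s0 st t1; apply/subcontinuumE; split.
- by apply: closed_comp => [x _|]; [exact: cf|exact: itv_closed].
- apply: connected_preimage; [exact: itv_closed|exact: segment_connected|].
  by move=> x /=; rewrite !in_itv /=; lra.
- by have [|x fx] := @f_surj s; [lra|exists x; rewrite /= fx in_itv /= lexx].
Qed.

(** The image of [A] is closed; if it misses [f x], the preimage of a short closed interval around
    [f x] is a subcontinuum, a neighbourhood of [x], and misses [A]. *)
Lemma jonesT_sub_fibres (A : set X) (x : X) : closed A -> jonesT A x ->
  exists2 a, A a & f a = f x.
Proof.
move=> cA Tx; apply: contrapT => nA; apply: Tx.
have fA : (~` (f @` A)) (f x) by move=> [a Aa fa]; apply: nA; exists a.
have [e /= e0 ex] : nbhs_ball (f x) (~` (f @` A)).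
  by rewrite nbhs_ballE; apply: open_nbhs_nbhs; split => //; exact/closed_openC/(closed_image arcf).
(* The interval is clipped to the range of [f]; the radius [e / 2] keeps it inside the open ball of
   radius [e]. *)
pose s := Num.max 0 (f x - e / 2); pose t := Num.min 1 (f x + e / 2).
have st : [/\ 0 <= s, s <= t, t <= 1, f x - e / 2 <= s & t <= f x + e / 2].
  have /andP[x0 x1] := f01 x; rewrite /s /t.
  by have [] := leP 0 (f x - e / 2); have [] := leP 1 (f x + e / 2) => *; split; lra.
case: st => s0 st t1 es et.
exists (f @^-1` `[s, t]%classic); split; first exact: subcontinuum_preimage_itv.
  have : nbhs x (f @^-1` ball (f x) (e / 2)).
    by apply: cf; apply: nbhsx_ballx; rewrite divr_gt0.
  apply: filterS => y; rewrite /ball /= ltr_norml in_itv /= => /andP[h1 h2].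
  by rewrite /s /t ge_max le_min; have := f01 y; lra.
move=> y /=; rewrite in_itv /= => /andP[h1 h2] Ay; apply: (ex (f y)); last by exists y.
by rewrite /ball /= ltr_norml; apply/andP; split; lra.
Qed.

Section irreducible.
Hypothesis irrX : irreducible X.

Lemma irreducible_endpoints :
  exists p q, [/\ irreducible_between p q, f p = 0 & f q = 1].
Proof.
have [p [q pq]] := irreducible_betweenP.1 irrX.
wlog fpq : p q pq / f p <= f q => [wl|].
  by have [|/ltW] := leP (f p) (f q); [exact: wl|apply: wl; exact: irreducible_between_sym].
have := pq _ (subcontinuum_preimage_itv _ fpq _).
have := f01 p; have := f01 q => /andP[q0 q1] /andP[p0 p1].
rewrite p0 q1 /= !in_itv /= !lexx fpq => /(_ isT isT isT isT)/seteqP[_ pqT].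
exists p, q; split=> //.
  have [|x fx] := @f_surj 0; first by rewrite lexx ler01.
  by have := pqT x I; rewrite /= fx in_itv /=; lra.
have [|x fx] := @f_surj 1; first by rewrite lexx ler01.
by have := pqT x I; rewrite /= fx in_itv /=; lra.
Qed.

(** With the preimages of [[0, f w1]] and [[f w2, 1]], [W] forms a subcontinuum joining the
    endpoints, hence X; neither preimage contains [x]. *)
Lemma fibre_sub_subcontinuum (W : set X) (w1 w2 x : X) : subcontinuum W -> W w1 -> W w2 ->
  f w1 < f x < f w2 -> W x.
Proof.
move=> sW W1 W2 /andP[x1 x2]; have [p [q [pq fp fq]]] := irreducible_endpoints.
have /andP[p1 _] := f01 w1; have /andP[_ p2] := f01 w2.
have /andP[_ p1'] := f01 w1; have /andP[p2' _] := f01 w2.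
have s1 := subcontinuum_preimage_itv (lexx 0) p1 p1'.
have s2 := subcontinuum_preimage_itv p2' p2 (lexx 1).
have : (f @^-1` `[0, f w1]%classic `|` W) `|` f @^-1` `[f w2, 1]%classic = [set: X].
  apply: pq.
  - apply: subcontinuumU => //.
      apply: subcontinuumU => //; exists w1; split => //.
      by rewrite /= in_itv /= lexx p1.
    by exists w2; split; [right|rewrite /= in_itv /= lexx p2].
  - by left; left; rewrite /= fp in_itv /= lexx p1.
  - by right; rewrite /= fq in_itv /= lexx p2.
by move=> /seteqP[_ /(_ x I)[[|//]|]]; rewrite /= in_itv /=; lra.
Qed.

(** The complement of the saturation of [U] is closed, and so is its image, which misses [f x]. *)
Lemma near_image_saturated_open (U : set X) (x : X) : saturated_open f -> open U -> U x ->
  exists2 e : R, 0 < e & forall t, 0 <= t <= 1 -> `|f x - t| < e -> exists2 y, U y & f y = t.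
Proof.
move=> so oU Ux.
have : nbhs (f x) (~` (f @` (~` (f @^-1` (f @` U))))).
  apply: open_nbhs_nbhs; split; last by move=> [y + fy]; apply; exists x.
  by apply: closed_openC; apply: (closed_image arcf); apply: open_closedC; exact: so.
rewrite -nbhs_ballE => -[e /= e0 ex]; exists e => // t t01 et.
have [z fz] := f_surj t01; apply: contrapT => nt; apply: (ex t et); exists z => //= -[y Uy fy].
by apply: nt; exists y; rewrite // fy.
Qed.

(** If [W] is a neighbourhood of [x] missing [a], openness makes [f] take every value near [f x]
    both on [W] and off it. But [W] contains every fibre strictly between two of its values. *)
Lemma fibres_sub_jonesT (A : set X) (a x : X) : saturated_open f ->
  A a -> f a = f x -> jonesT A x.
Proof.
move=> so Aa fax [W [sW Wx WA]].
have nWa : ~ W a by move=> /WA; exact.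
have [e1 e10 h1] := near_image_saturated_open so (open_interior W) Wx.
have [e2 e20 h2] := near_image_saturated_open so (subcontinuum_openC sW) nWa.
pose e := Num.min (Num.min e1 e2) 1.
have [e0 ee1 ee2 e1'] : [/\ 0 < e, e <= e1, e <= e2 & e <= 1].
  rewrite /e; have [] := leP e1 e2.
    by have [] := leP e1 1 => *; split; lra.
  by have [] := leP e2 1 => *; split; lra.
(* As [f x] may be 0 or 1, [s] is moved by [e / 4] away from the nearer end; [e <= 1] leaves room
   for [e / 8] on both sides. *)
have [s [s0 s1 sx]] : exists s, [/\ 0 <= s - e / 8, s + e / 8 <= 1 & `|f x - s| <= e / 4].
  have /andP[fx0 fx1] := f01 x.
  have [fx|fx] := leP (f x) (1/2).
    by exists (f x + e / 4); split; [lra|lra|rewrite ler_norml; apply/andP; split; lra].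
  by exists (f x - e / 4); split; [lra|lra|rewrite ler_norml; apply/andP; split; lra].
move: sx; rewrite ler_norml => /andP[sx1 sx2].
have h1' t : 0 <= t <= 1 -> - (e / 2) < f x - t < e / 2 -> exists2 y, W y & f y = t.
  move=> t01 /andP[? ?]; have [|y Wy <-] := h1 t t01.
    by rewrite ltr_norml; apply/andP; split; lra.
  by exists y => //; exact: interior_subset.
have [||w1 W1 fw1] := h1' (s - e / 8); [lra|by apply/andP; split; lra|].
have [||w2 W2 fw2] := h1' (s + e / 8); [lra|by apply/andP; split; lra|].
have [||y Wy fy] := h2 s; [lra|by rewrite fax ltr_norml; apply/andP; split; lra|].
by apply: Wy; apply: fibre_sub_subcontinuum sW W1 W2 _; lra.
Qed.

Lemma jonesTE (A : set X) : saturated_open f -> closed A -> jonesT A = f @^-1` (f @` A).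
Proof.
move=> so cA; apply/seteqP; split=> x; first by move=> /(jonesT_sub_fibres cA)[a]; exists a.
by move=> [a]; exact: fibres_sub_jonesT.
Qed.

(** A [K] with interior lies in no single fibre, so [f] takes two values on it. It contains the
    fibre over their midpoint [c] and is the union of its parts below and above [c], each with that
    fibre added; these are connected because [K] and the fibre are. *)
Lemma type_lambda_arc_map : type_lambda X.
Proof.
split=> // K sK iK; apply: contrapT => /eqP/set0P[k Kk].
have [_ _ _ f0] := arcf.
have [w1 [w2 [K1 K2 w12]]] : exists w1 w2, [/\ K w1, K w2 & f w1 < f w2].
  apply: contrapT => nK; suff : (f @^-1` [set f k])° k by rewrite f0.
  have Kk' := interior_subset Kk; apply: filterS Kk => y Ky.
  apply: contrapT => /eqP; rewrite neq_lt => /orP[h|h].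
    by apply: nK; exists y, k.
  by apply: nK; exists k, y.
have [cK kK _] := sK; have clK := subcontinuum_closed sK.
pose c := (f w1 + f w2) / 2; have /andP[w10 _] := f01 w1; have /andP[_ w21] := f01 w2.
have c01 : 0 <= c <= 1 by rewrite /c; lra.
have [z fz] := f_surj c01.
have FK : f @^-1` [set c] `<=` K.
  by move=> y fy; apply: fibre_sub_subcontinuum sK K1 K2 _; rewrite fy /c; lra.
have oL : open (f @^-1` [set t | t < c]) by apply: open_comp => [x _|]; [exact: cf|exact: open_lt].
have oG : open (f @^-1` [set t | c < t]) by apply: open_comp => [x _|]; [exact: cf|exact: open_gt].
have KLG x : f x < c \/ f x > c \/ f x = c.
  by case: (ltgtP (f x) c); [left|right; left|right; right].
have [connF FF0] : connected (f @^-1` [set c]) /\ f @^-1` [set c] !=set0.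
  by split; [case: arcf|exists z].
have sub1 U V : open U -> open V -> (forall x, ~ (U x /\ V x)) ->
    (forall x, f x != c -> U x \/ V x) -> (forall x, V x -> f x != c) ->
    subcontinuum (f @^-1` [set c] `|` (K `&` U)).
  move=> oU oV dUV UV Vc; apply/subcontinuumE; split.
  - rewrite (_ : _ `|` _ = K `&` ~` V); first by apply: closedI => //; exact: open_closedC.
    apply/seteqP; split=> x.
      case=> [fx|[Kx Ux]].
        by split; [exact: FK|move=> /Vc; rewrite fx eqxx].
      by split=> // Vx; apply: (dUV x).
    move=> [Kx Vx]; have [fx|/UV] := eqVneq (f x) c; first by left.
    by case=> //; right.
  - apply: (connected_setU_open (V := V)) => //.
      move=> x Kx; have [fx|/UV] := eqVneq (f x) c; first by left.
      by right.
    by rewrite -subset0 => x [[_ Ux] Vx]; apply: (dUV x).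
  - by exists z; left.
apply: iK; exists (f @^-1` [set c] `|` (K `&` (f @^-1` [set t | t < c]))),
  (f @^-1` [set c] `|` (K `&` (f @^-1` [set t | c < t]))); split.
- apply: (sub1 _ (f @^-1` [set t | c < t])) => // x /=; [lra| |by move=> /gt_eqF ->].
  by rewrite neq_lt => /orP.
- apply: (sub1 _ (f @^-1` [set t | t < c])) => // x /=; [lra| |by move=> /lt_eqF ->].
  by rewrite neq_lt => /orP[|]; [right|left].
- split=> [x [/FK//|[]//]|/(_ _ K2)]; rewrite /= /c => -[|[_]]; lra.
- split=> [x [/FK//|[]//]|/(_ _ K1)]; rewrite /= /c => -[|[_]]; lra.
- apply/seteqP; split=> x; last by move=> [[/FK//|[]//]|[/FK//|[]//]].
  by move=> Kx; have [|[|]] := KLG x; [left; right|right; right|left; left].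
Qed.

End irreducible.
End arc_map_theory.

(** * Continuity of T on the hyperspace, and the two implications *)

Section hyperspace_continuity.
Context {R : realType} {X : continuumType R}.

Lemma thickeningS (r s : R) (A : set X) : r <= s -> thickening r A `<=` thickening s A.
Proof. by move=> rs x [a Aa ax]; exists a => //; exact: le_ball rs _ ax. Qed.

Lemma jonesT_hyper_continuous :
  (forall e : R, 0 < e -> exists2 d : R, 0 < d & forall A B : set X,
    closed A -> closed B -> A !=set0 -> B !=set0 -> A `<=` thickening d B ->
    jonesT A `<=` thickening e (jonesT B)) ->
  continuous (@jonesT_hyper R X).
Proof.
move=> unif A U /nbhs_ballP[e /= e0 eU].
have [|d d0 dT] := unif (e / 2); first by rewrite divr_gt0.
suff : nbhs A (@jonesT_hyper R X @^-1` U) by [].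
apply/nbhs_ballP; exists d => // B; rewrite ballEmdist => /hausdorff_dist_ltP[r [r0 [AB BA]] rd].
apply: eU; rewrite ballEmdist; apply: (@le_lt_trans _ _ (e / 2)); last by lra.
apply: hausdorff_dist_le; split; first by lra.
have [cA A0] := svalP A; have [cB B0] := svalP B.
split; apply: dT => //.
  by apply: subset_trans AB _; apply: thickeningS; exact: ltW.
by apply: subset_trans BA _; apply: thickeningS; exact: ltW.
Qed.

Lemma jonesT_hyper_lower_semicontinuous :
  continuous (@jonesT_hyper R X) -> jonesT1_lower_semicontinuous X.
Proof.
move=> cT x z U Tz; rewrite -nbhs_ballE => -[e /= e0 eU].
have c1 (y : X) : closed [set y] /\ [set y] !=set0.
  by split; [exact: subcontinuum_closed (subcontinuum1 y)|exists y].
pose pt y : hyperspace X := exist _ [set y] (c1 y).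
have /nbhs_ballP[d /= d0 dT] :
    nbhs (pt x) (@jonesT_hyper R X @^-1` ball (jonesT_hyper (pt x)) e).
  by apply: cT; exact: nbhsx_ballx.
have d20 : 0 < d / 2 by rewrite divr_gt0.
apply: filterS (nbhsx_ballx x _ d20) => x' xx'.
have /dT : ball (pt x) d (pt x').
  rewrite ballEmdist; apply: (@le_lt_trans _ _ (d / 2)); last by lra.
  apply: hausdorff_dist_le; split => //; split=> _ ->.
    by exists x' => //; exact: ball_sym.
  by exists x.
rewrite /= ballEmdist => /hausdorff_dist_ltP[r [r0 [xT _]] re].
have [z' Tz' zz'] := xT z Tz; exists z'; split=> //; apply: eU.
by apply: ball_sym; apply: le_ball zz'; exact: ltW.
Qed.

(** Compactness makes [near_image_saturated_open] uniform in the point. *)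
Lemma arc_map_lift (f : X -> R) : arc_map f -> saturated_open f ->
  forall e : R, 0 < e -> exists2 d : R, 0 < d &
    forall x t, 0 <= t <= 1 -> `|f x - t| < d -> exists2 y, ball x e y & f y = t.
Proof.
move=> arcf so e e0; have [cf _ _ _] := arcf.
have /compact_near_coveringP cX := @continuum_compact R X.
have : \forall d \near 0^'+, [set: X] `<=` (fun x => forall t, 0 <= t <= 1 -> `|f x - t| < d ->
    exists2 y, ball x e y & f y = t).
  apply: cX => x _; have e20 : 0 < e / 2 by rewrite divr_gt0.
  have [|r r0 h] := near_image_saturated_open arcf (x := x) so (open_interior (ball x (e / 2))).
    exact: nbhsx_ballx.
  have r20 : 0 < r / 2 by rewrite divr_gt0.
  exists (ball x (e / 2) `&` (f @^-1` ball (f x) (r / 2)), [set d | d < r / 2]) => /=.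
    split; last exact: nbhs_right_lt.
    by apply: filterI; [exact: nbhsx_ballx|apply: cf; exact: nbhsx_ballx].
  move=> [x' d] [/= [xx' fxx'] dr] t t01 xt.
  have [|y /interior_subset xy fy] := h t t01.
    move: fxx' xt; rewrite /ball /= !ltr_norml => /andP[? ?] /andP[? ?].
    by apply/andP; split; lra.
  by exists y => //; rewrite [e]splitr; apply: ball_triangle xy; exact: ball_sym.
move=> nd; near (0 : R)^'+ => d; exists d; first by near: d; exact: nbhs_right_gt.
by move=> x t; apply: (near nd d).
Unshelve. all: by end_near. Qed.

Lemma continuum_uniformly_continuous (f : X -> R) : continuous f ->
  forall e : R, 0 < e -> exists2 d : R, 0 < d &
    forall x y, ball x d y -> `|f x - f y| < e.
Proof.
move=> cf e e0.
have /compact_near_coveringP cX := @continuum_compact R X.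
have : \forall d \near 0^'+, [set: X] `<=` (fun x => forall y, ball x d y -> `|f x - f y| < e).
  apply: cX => x _; have e20 : 0 < e / 2 by rewrite divr_gt0.
  have /nbhs_ballP[r /= r0 h] : nbhs x (f @^-1` ball (f x) (e / 2)).
    by apply: cf; exact: nbhsx_ballx.
  have r20 : 0 < r / 2 by rewrite divr_gt0.
  exists (ball x (r / 2), [set d | d < r / 2]) => /=.
    by split; [exact: nbhsx_ballx|exact: nbhs_right_lt].
  move=> [x' d] [/= xx' dr] y x'y.
  have /h hx' : ball x r x' by apply: le_ball xx'; lra.
  have /h hy : ball x r y.
    by rewrite [r]splitr; apply: ball_triangle xx' _; apply: le_ball x'y; exact: ltW.
  move: hx' hy; rewrite /ball /= !ltr_norml => /andP[? ?] /andP[? ?].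
  by apply/andP; split; lra.
move=> nd; near (0 : R)^'+ => d; exists d; first by near: d; exact: nbhs_right_gt.
by move=> x y; apply: (near nd d).
Unshelve. all: by end_near. Qed.

(** A subcontinuum showing two points comparable would, with the closure of its complement,
    decompose X. So all points are incomparable, and T({a}) is already X. *)
Lemma indecomposable_jonesT (A : set X) : irreducible X ->
  indecomposable [set: X] -> A !=set0 -> jonesT A = [set: X].
Proof.
move=> /irreducible_betweenP[p [q pq]] iX [a Aa]; apply/seteqP; split=> // x _ [W [sW Wx WA]].
have Nax : ~ jonesT [set a] x.
  by apply; exists W; split => // y Wy ya; apply: (WA y Wy); rewrite ya.
have nprec z y : ~ precedes p z y.
  move=> [K [sK Kp Kz Ky]]; apply: iX; exists K, (closure (~` K)); split => //.
  - exact: (subcontinuum_closure_setC pq sK Kp Ky).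
  - by split=> // /(_ y I).
  - by rewrite closure_setC; split=> // /(_ z I).
  - apply/seteqP; split=> // y' _; have [|Ky'] := pselect (K y'); first by left.
    by right; exact: subset_closure.
by apply: Nax; apply/(jonesT1P pq); split.
Qed.

(** The half containing [p] omits [q], so the other half is a neighbourhood of [q], and it omits
    [p]: this is the relation seen from [q]. *)
Lemma decomposable_precedes (p q : X) : irreducible_between p q ->
  decomposable [set: X] -> precedes p p q.
Proof.
move=> pq [A [B [sA sB [_ AT] [_ BT] AB]]].
wlog Ap : A B sA sB AT BT AB / A p => [wl|].
  have [Ap|Bp] : (A `|` B) p by rewrite -AB.
    exact: (wl A B).
  by apply: (wl B A) => //; rewrite setUC.
have Aq : ~ A q by move=> Aq; apply: AT; rewrite (pq A).
have nAB : ~` A `<=` B.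
  by move=> x Ax; have [] : (A `|` B) x by rewrite -AB.
apply/(precedes_sym pq); exists B; split=> //.
- exact: nAB.
- by apply: filterS nAB (subcontinuum_nbhsC sA Aq).
- by move=> Bp; apply: BT; rewrite (pq B) //; exact: nAB.
Qed.

(** T(A) is the saturation of [A] under [f]. Uniform continuity carries a small displacement of [A]
    to the values of [f], and the uniform lifting of values brings it back to the fibres. *)
Lemma continuously_irreducible_continuous : irreducible X ->
  continuously_irreducible R X -> continuous (@jonesT_hyper R X).
Proof.
move=> irrX [_ [G [aG _] [dG _ oG]]]; have [f arcf fP] := arc_decomposition_map aG.
have so : saturated_open f.
  move=> U /oG; rewrite /open /= /quotient_open; congr open.
  by apply/seteqP; split=> x [y Uy /fP ?]; exists y.
apply: jonesT_hyper_continuous => e e0.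
have [d1 d10 lift] := arc_map_lift arcf so e0.
have [cf rf _ _] := arcf.
have [d d0 ucf] := continuum_uniformly_continuous cf d10.
exists d => // A B cA cB A0 B0 AB x; rewrite !(jonesTE arcf) // => -[a Aa fax].
have [b Bb ba] := AB a Aa.
have [||y xy fy] := lift x (f b).
- have : range f (f b) by exists b.
  by rewrite rf /= in_itv.
- by rewrite -fax; apply: ucf; exact: ball_sym.
by exists y; [exists b|exact: ball_sym].
Qed.

Lemma continuous_arc_map (p q : X) : irreducible_between p q -> precedes p p q ->
  continuous (@jonesT_hyper R X) -> exists2 f : X -> R, arc_map f & saturated_open f.
Proof.
move=> pq ppq cT; have lscT := jonesT_hyper_lower_semicontinuous cT.
have [u cu uP] := exists_utility pq lscT.
have upq : u p < u q by apply/uP.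
(* A witness that some point precedes [p] would both contain and omit [p]; so [u] is least at [p]
   and, by symmetry, greatest at [q]. *)
have ulo x : u p <= u x.
  by rewrite leNgt; apply/negP => /uP[K [_ Kp _]].
have uhi x : u x <= u q.
  by rewrite leNgt; apply/negP => /uP/(precedes_sym pq)[K [_ Kp _]].
have dpq : 0 < u q - u p by rewrite subr_gt0.
pose f x := (u x - u p) / (u q - u p).
have fE x y : f x = f y <-> u x = u y.
  split=> [|]; last by rewrite /f => ->.
  by move=> /(mulIf (invr_neq0 (lt0r_neq0 dpq)))/addIr.
have fib x : f @^-1` [set f x] = jonesT [set x].
  apply/seteqP; split=> y.
    move=> /fE uxy; apply/(jonesT1P pq).
    by split=> /uP; rewrite uxy ltxx.
  move=> /(jonesT1P pq)[yx xy]; apply/fE/eqP; rewrite eq_le !leNgt.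
  by apply/andP; split; apply/negP => /uP.
(* The fibres are the sets T({x}), so lower semicontinuity makes saturations of open sets open. *)
have so : saturated_open f.
  move=> U oU; rewrite openE => x [y Uy fyx].
  have Txy : jonesT [set x] y by rewrite -fib.
  have := lscT x y U Txy (open_nbhs_nbhs (conj oU Uy)).
  by apply: filterS => x' [y' []]; rewrite -fib => fx' Uy'; exists y'.
have cf : continuous f.
  move=> x; apply: cvgM; last exact: cvg_cst.
  by apply: cvgB; [exact: cu|exact: cvg_cst].
have fp : f p = 0 by rewrite /f subrr mul0r.
have fq : f q = 1 by rewrite /f divff // gt_eqF.
exists f => //; split=> //.
- apply/seteqP; split=> [_ [x _ <-]|t].
    rewrite /= in_itv /= divr_ge0 ?subr_ge0 ?(ltW dpq) ?ulo //=.
    by rewrite ler_pdivrMr // mul1r lerD2r.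
  have /connected_intervalP itvf : connected (range f).
    apply: connected_continuous_connected; first exact: continuum_connected.
    exact: continuous_subspaceT.
  rewrite /= in_itv /= => t01; apply: (itvf 0 1) => //; [by exists p|by exists q].
- move=> t; have [[x <-]|ft] := pselect (exists x, f x = t).
    rewrite fib; apply: connected_jonesT1 pq _ _ => // pEq.
    by move: upq; rewrite pEq ltxx.
  rewrite (_ : _ @^-1` _ = set0); first exact: connected0.
  by rewrite -subset0 => x fx; apply: ft; exists x.
(* A fibre with interior is the saturation of that interior, hence open as well as closed, hence X,
   although [f p] and [f q] differ. *)
- move=> t; apply: contrapT => /eqP/set0P[x xt].
  have fx := interior_subset xt.
  have sat : f @^-1` [set t] = f @^-1` (f @` (f @^-1` [set t])°).
    apply/seteqP; split=> y; first by move=> fy; exists x; rewrite // fx fy.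
    by move=> [z /interior_subset fz fzy]; rewrite /= -fzy.
  have ftT : f @^-1` [set t] = [set: X].
    apply: connected_setT_clopen; first exact: continuum_connected.
    - by rewrite sat; apply: so; exact: open_interior.
    - by apply: closed_comp => [y _|]; [exact: cf|exact: closed_eq].
    - by exists x.
  have ft y : f y = t by have : [set: X] y by []; rewrite -ftT.
  by have := ft p; rewrite -(ft q) fp fq => /eqP; rewrite eq_sym oner_eq0.
Qed.

(** The fibres of [f] are finest because each lies in some T({x}), by openness, and T({x}) lies in
    one fibre of the map of any arc decomposition. *)
Lemma continuously_irreducible_arc_map (f : X -> R) : irreducible X -> arc_map f ->
  saturated_open f -> continuously_irreducible R X.
Proof.
move=> irrX arcf so; split; first exact: type_lambda_arc_map arcf irrX.
exists (fibres f); last first.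
  by split; [exact: decomposition_fibres|exact: closed_map_fibres|exact: open_map_fibres].
split=> [|H aH]; first exact: arc_decomposition_fibres.
have [h arch hP] := arc_decomposition_map aH.
have [[dH _] _ _ _] := aH.
move=> _ [x _ <-]; have [B HB Bx] := decomposition_block x dH; exists B => // y fyx.
have c1 : closed [set x] by exact: subcontinuum_closed (subcontinuum1 x).
have Txy : jonesT [set x] y by apply: (fibres_sub_jonesT arcf irrX so (a := x)).
have [_ -> hxy] := jonesT_sub_fibres arch c1 Txy.
by apply/(same_blockP _ dH HB Bx)/quotient_mapP/hP.
Qed.

End hyperspace_continuity.

Theorem theorem3p14 (R : realType) (X : continuumType R)
    (hX : irreducible X) :
  indecomposable [set: X] \/ continuously_irreducible R X <->
  continuous (@jonesT_hyper R X).
Proof.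
split=> [[iX|]|cT].
(* In the indecomposable case T is constant with value X, so any radius will do. *)
- apply: jonesT_hyper_continuous => e e0; exists 1 => // A B _ _ A0 B0 _ x _.
  by exists x; [rewrite indecomposable_jonesT|exact: ballxx].
- exact: continuously_irreducible_continuous.
- have [dX|] := pselect (decomposable [set: X]); last by left.
  have [p [q pq]] := irreducible_betweenP.1 hX; right.
  have [f arcf so] := continuous_arc_map pq (decomposable_precedes pq dX) cT.
  exact: continuously_irreducible_arc_map arcf so.
Qed.
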